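(* Let $c \in \mathbb{R}^n$, let $Q$ be a real symmetric $n \times n$ matrix, let $\sigma > 0$, and let $m(s) = c^T s + \frac12 s^T Q s + \frac13 \sigma \|s\|^3$ for $s \in \mathbb{R}^n$. Let $k$ be the number of distinct negative eigenvalues of $Q$. Then the number of distinct values taken by $m$ at its stationary points is at most $2(k+1)$; that is, the set $\{m(s) : s \in \mathbb{R}^n \text{ is a stationary point of } m\}$ has at most $2(k+1)$ elements.
   Context: $\|\cdot\|$ is the Euclidean norm. A point $s^* \in \mathbb{R}^n$ is called a stationary point of $m$ if $\nabla m(s^* ) = c + Q s^* + \sigma \|s^*\| s^* = 0$; equivalently, $c + Q s^* + \lambda s^* = 0$ with $\lambda = \sigma \|s^*\|$. *)

(* Defs.v *)
From HB Require Import structures.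
From mathcomp Require Import all_boot all_order all_algebra.
From mathcomp Require Import all_classical all_reals all_analysis.
From mathcomp Require Import ring lra.
Import Order.TTheory GRing.Theory Num.Theory numFieldNormedType.Exports.

Set Implicit Arguments.
Unset Strict Implicit.
Unset Printing Implicit Defensive.

Local Open Scope classical_set_scope.
Local Open Scope ring_scope.

(* The library norm `|s| on 'cV_n is the sup norm, hence this definition. *)
Definition enorm (R : realType) (n : nat) (s : 'cV[R]_n) : R :=
  Num.sqrt (\sum_i s i 0 ^+ 2).

Definition cubic_model (R : realType) (n : nat) (c : 'cV[R]_n) (Q : 'M[R]_n)
    (sigma : R) (s : 'cV[R]_n) : R :=
  (c^T *m s) 0 0 + 2^-1 * (s^T *m Q *m s) 0 0 + 3^-1 * sigma * enorm s ^+ 3.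

(* 'D_v f s is a default value when f is not derivable; is_derive_cubic_model
   shows that this never happens for a cubic_model with Q symmetric. *)
Definition gradient (R : realType) (n : nat) (f : 'cV[R]_n -> R)
    (s : 'cV[R]_n) : 'cV[R]_n :=
  \col_i 'D_(delta_mx i 0) f s.

Definition stationary (R : realType) (n : nat) (f : 'cV[R]_n -> R)
    (s : 'cV[R]_n) : Prop :=
  gradient f s = 0.

Lemma mx11_tr (R : realType) (A : 'M[R]_1) : A^T = A.
Proof. by apply/matrixP=> i j; rewrite mxE !ord1. Qed.

Lemma is_derive_line (R : realType) (n : nat) (f : 'cV[R]_n -> R)
    (s v : 'cV[R]_n) (g : R -> R) (df : R) :
  (forall h, f (h *: v + s) = g h) -> is_derive (0 : R) 1 g df ->
  is_derive s v f df.
Proof.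
move=> fg [dg gE].
have e : (fun h => h^-1 *: ((f \o shift s) (h *: v) - f s)) =
         (fun h : R => h^-1 *: ((g \o shift 0) (h *: (1 : R)) - g 0)).
  apply/funext => h /=; rewrite fg addr0 -(fg 0) scale0r add0r.
  by rewrite [h *: 1]mulr1.
split; first by rewrite /derivable e; exact: dg.
by rewrite /derive e -gE.
Qed.

Lemma enorm_sq (R : realType) (n : nat) (s : 'cV[R]_n) :
  \sum_i s i 0 ^+ 2 = (s^T *m s) 0 0.
Proof. by rewrite mxE; apply: eq_bigr => i _; rewrite mxE expr2. Qed.

Lemma is_derive_cube_norm (R : realType) (a b d : R) :
  0 <= a -> 0 <= d -> (a = 0 -> b = 0) ->
  is_derive (0 : R) 1 (fun h => Num.sqrt (a + 2 * h * b + h ^+ 2 * d) ^+ 3)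
    (3 * Num.sqrt a * b).
Proof.
move=> a0 d0 ab; have [az|an] := eqVneq a 0.
  rewrite az (ab az) sqrtr0 !mulr0.
  have E (h : R) : Num.sqrt (0 + 2 * h * 0 + h ^+ 2 * d) ^+ 3
      = h * (Num.sqrt d ^+ 3 * (h * `|h|)).
    rewrite mulr0 !add0r sqrtrM ?sqr_ge0// sqrtr_sqr exprMn.
    by rewrite exprS real_normK ?num_real//; ring.
  rewrite (_ : (fun h => _) = fun h => h * (Num.sqrt d ^+ 3 * (h * `|h|)));
    last exact/funext.
  suff H : (fun h : R => h^-1 *: (((fun h => h * (Num.sqrt d ^+ 3 * (h * `|h|)))
      \o shift 0) (h *: (1:R)) - 0 * (Num.sqrt d ^+ 3 * (0 * `|0 : R|)))) @ 0^' --> (0:R).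
    split; first by apply/cvg_ex; exists 0; exact: H.
    by apply/cvg_lim => //; exact: H.
  have K : (fun h : R => Num.sqrt d ^+ 3 * (h * `|h|)) @ 0^' --> (0 : R).
    apply: cvg_trans; first exact/cvg_app/nbhs_dnbhs.
    have : {for 0, continuous (fun h : R => Num.sqrt d ^+ 3 * (h * `|h|))}.
      apply: cvgM; first exact: cvg_cst.
      by apply: cvgM; [exact: cvg_id | exact: norm_continuous].
    by rewrite /prop_for /continuous_at mul0r mulr0.
  apply: (cvg_trans _ K); apply: near_eq_cvg; near=> h.
  have h0 : h != 0 by near: h; exact: nbhs_dnbhs_neq.
  rewrite /= addr0 [h *: 1]mulr1 mul0r subr0 /GRing.scale/=.
  by rewrite mulKf.
have ap : 0 < a by rewrite lt_neqAle eq_sym an.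
have D1 : is_derive (0:R) 1 (fun h : R => a + 2 * h * b + h ^+ 2 * d) (2 * b).
  apply: is_derive_eq; rewrite /GRing.scale/=; ring.
have e0 : a + 2 * 0 * b + 0 ^+ 2 * d = a by ring.
have D2 : is_derive (a + 2 * 0 * b + 0 ^+ 2 * d) 1 (@Num.sqrt R) (2 * Num.sqrt a)^-1.
  by rewrite e0; exact: is_derive1_sqrt.
have D3 := @is_derive1_comp _ (@Num.sqrt R)
  (fun h : R => a + 2 * h * b + h ^+ 2 * d) 0 _ _ D2 D1.
have D4 := is_deriveX 3 D3.
apply: (is_derive_eq D4).
rewrite /comp e0 /GRing.scale/=.
have : Num.sqrt a != 0 by rewrite sqrtr_eq0 -ltNge.
move: (Num.sqrt a) => r r0; field; exact: r0.
Unshelve. all: by end_near. Qed.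

Lemma is_derive_cubic_model (R : realType) (n : nat) (c : 'cV[R]_n)
    (Q : 'M[R]_n) (sigma : R) (s v : 'cV[R]_n) :
  Q^T = Q ->
  is_derive s v (cubic_model c Q sigma)
    ((v^T *m (c + Q *m s + (sigma * enorm s) *: s)) 0 0).
Proof.
move=> Qs.
have quad (A : 'M[R]_n) h : A^T = A ->
    ((h *: v + s)^T *m A *m (h *: v + s)) 0 0 = (s^T *m A *m s) 0 0
      + 2 * h * (v^T *m A *m s) 0 0 + h ^+ 2 * (v^T *m A *m v) 0 0.
  move=> As.
  have sv : (s^T *m A *m v) 0 0 = (v^T *m A *m s) 0 0.
    by rewrite -[s^T *m A *m v]mx11_tr !trmx_mul trmxK As mulmxA.
  have -> : (h *: v + s)^T = h *: v^T + s^T by apply/matrixP => i j; rewrite !mxE.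
  rewrite !mulmxDl !mulmxDr -!scalemxAl -!scalemxAr.
  have E (x y z t : 'M[R]_1) :
      (h *: (h *: x) + h *: y + (h *: z + t)) 0 0
      = h * (h * x 0 0) + h * y 0 0 + (h * z 0 0 + t 0 0) by rewrite !mxE.
  rewrite E sv; ring.
have dotE h : \sum_i (h *: v + s) i 0 ^+ 2 = (s^T *m s) 0 0
    + 2 * h * (v^T *m s) 0 0 + h ^+ 2 * (v^T *m v) 0 0.
  by rewrite enorm_sq; have := quad 1%:M h (trmx1 _ _); rewrite !mulmx1.
have dot_ge0 (x : 'cV[R]_n) : 0 <= (x^T *m x) 0 0.
  by rewrite -enorm_sq; apply: sumr_ge0 => i _; exact: sqr_ge0.
have ab : (s^T *m s) 0 0 = 0 -> (v^T *m s) 0 0 = 0.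
  rewrite -enorm_sq => /eqP; rewrite psumr_eq0; last by move=> i _; exact: sqr_ge0.
  move=> /allP s0; rewrite mxE big1// => i _.
  have := s0 i (mem_index_enum i); rewrite sqrf_eq0 => /eqP ->.
  by rewrite mulr0.
have D := is_derive_cube_norm (dot_ge0 s) (dot_ge0 v) ab.
apply: (@is_derive_line _ _ _ _ _ (fun h => (c^T *m s) 0 0 + h * (c^T *m v) 0 0
   + 2^-1 * ((s^T *m Q *m s) 0 0 + 2 * h * (v^T *m Q *m s) 0 0
             + h ^+ 2 * (v^T *m Q *m v) 0 0)
   + 3^-1 * sigma * Num.sqrt ((s^T *m s) 0 0 + 2 * h * (v^T *m s) 0 0
             + h ^+ 2 * (v^T *m v) 0 0) ^+ 3)).
  move=> h; rewrite /cubic_model /enorm dotE quad//; congr (_ + _ + _).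
  by rewrite mulmxDr -scalemxAr mxE [X in X + _]mxE addrC.
apply: is_derive_eq.
rewrite !mulmxDr -scalemxAr /GRing.scale/= mulmxA /enorm enorm_sq.
have -> : (c^T *m v) 0 0 = (v^T *m c) 0 0.
  by rewrite -[c^T *m v]mx11_tr trmx_mul trmxK.
have E (x y z : 'M[R]_1) r : (x + y + r *: z) 0 0 = x 0 0 + y 0 0 + r * z 0 0.
  by rewrite !mxE.
by rewrite E; field.
Qed.

Lemma stationary_cubic_model (R : realType) (n : nat) (c : 'cV[R]_n)
    (Q : 'M[R]_n) (sigma : R) (s : 'cV[R]_n) :
  Q^T = Q ->
  stationary (cubic_model c Q sigma) s <->
  c + Q *m s + (sigma * enorm s) *: s = 0.
Proof.
move=> Qs.
have D v := is_derive_cubic_model c sigma s v Qs.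
have -> : c + Q *m s + (sigma * enorm s) *: s
    = gradient (cubic_model c Q sigma) s.
  apply/matrixP => i j; rewrite ord1 [RHS]mxE.
  have -> : 'D_(delta_mx i 0) (cubic_model c Q sigma) s = _ :=
    @derive_val _ _ _ _ _ _ _ (D (delta_mx i 0)).
  by rewrite trmx_delta -rowE [RHS]mxE.
by [].
Qed.

(* Main.v *)
(* Put l = sigma * |s|. At stationary points m is determined by |s|, so it is
   enough to count the possible multipliers l. If p, q, r are stationary with
   multipliers a < b < d, then Q has an eigenvalue in ]-d, -a[. Otherwise
   (Q + a)(Q + d) is positive semidefinite; since it maps
   w = (d - b) p + (b - a) r - (d - a) q to a positive multiple of q, the inner
   product of w and q is nonnegative. As |p|, |q|, |r| are proportional to
   a, b, d, this forces equality in Cauchy-Schwarz, so p and r are multiples of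
   q, and then q = 0, which is absurd. Given N multipliers l_0 < l_1 < ..., the
   disjoint intervals ]l_0, l_2[, ]l_2, l_4[, ... each contain the opposite of a
   negative eigenvalue, whence N <= 2 k + 2. *)
Require Import Defs.
From HB Require Import structures.
From mathcomp Require Import all_boot all_order all_algebra.
From mathcomp Require Import all_classical all_reals all_analysis.
From mathcomp Require Import complex finmap ring lra zify.
Import Order.TTheory GRing.Theory Num.Theory numFieldNormedType.Exports.

Set Implicit Arguments.
Unset Strict Implicit.
Unset Printing Implicit Defensive.

Local Open Scope classical_set_scope.
Local Open Scope card_scope.
Local Open Scope ring_scope.

(** * Positivity of quadratic forms from the spectrum *)

Lemma spectral_diag_eigenvalue (C : numClosedFieldType) (n : nat)
    (A : 'M[C]_n) (i : 'I_n) :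
  A \is normalmx -> eigenvalue A (spectral_diag A 0 i).
Proof.
move=> /orthomx_spectralP AE; have Pu := spectral_unit A.
apply/eigenvalueP; exists (row i (spectralmx A)).
  rewrite {2}AE -row_mul !mulmxA mulmxV// mul1mx row_mul row_diag_mx -scalemxAl.
  by rewrite -rowE.
apply: contraTneq Pu => r0; apply/negP => Pu.
have : delta_mx 0 i = 0 :> 'rV[C]_n.
  by rewrite -[delta_mx 0 i](mulmxK Pu) -rowE r0 mul0mx.
by move=> /rowP/(_ i); rewrite !mxE !eqxx => /eqP; rewrite oner_eq0.
Qed.

(** Over the complex numbers a unitary [P] diagonalises [Q]. With [u = P *m v], [v] being [w] read
    as a complex vector, the form becomes the sum of (x_i + a) (x_i + d) |u_i|^2 over the real
    eigenvalues x_i. *)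
Lemma psd_shift_mul (R : rcfType) (n : nat) (Q : 'M[R]_n) (a d : R)
    (w : 'cV[R]_n) :
  Q^T = Q ->
  (forall x, eigenvalue Q x -> 0 <= (x + a) * (x + d)) ->
  0 <= (w^T *m ((Q + a%:M) *m (Q + d%:M)) *m w) 0 0.
Proof.
move=> Qs Qev.
pose f := real_complex R; pose A := map_mx f Q; pose v := map_mx f w.
have Areal : A \is a mxOver Num.real.
  by apply/mxOverP => i j; rewrite mxE complex_real.
have Asym : A \is symmetricmx.
  apply/is_hermitianmxP; rewrite /= expr0 scale1r map_mx_id//.
  by rewrite /A map_trmx Qs.
have Aherm := realsym_hermsym Asym Areal.
have An := hermitian_normalmx Aherm.
have /mxOverP spreal := hermitian_spectral_diag_real Aherm.
have spev i := spectral_diag_eigenvalue i An.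
set sp := spectral_diag A in spreal spev; pose P := spectralmx A.
have Pu : P \in unitmx := spectral_unit A.
have AE : A = invmx P *m diag_mx sp *m P by apply/orthomx_spectralP.
have shiftE x : map_mx f (Q + x%:M)
    = invmx P *m diag_mx (sp + const_mx (f x)) *m P.
  rewrite map_mxD map_scalar_mx -/A raddfD/= diag_const_mx mulmxDr mulmxDl -AE.
  by rewrite [_ *m (f x)%:M]scalar_mxC mulmxKV.
(* As [w] is real, its transpose is a conjugate transpose, so the form is Hermitian in [v]. *)
have vT : map_mx f w^T = (map_mx Num.conj v)^T.
  by apply/matrixP => i j; rewrite !mxE conj_Creal// complex_real.
set M := w^T *m _ *m w; suff H : 0 <= f (M 0 0) by rewrite -lecR; exact: H.
have -> : f (M 0 0) = (map_mx f M) 0 0 by rewrite [RHS]mxE.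
rewrite !map_mxM !shiftE vT -/v !mulmxA mulmxK//.
rewrite -[_ *m diag_mx _ *m diag_mx _]mulmxA.
rewrite mulmx_diag invmx_unitary ?spectral_unitarymx// -/P -mulmxA.
pose u := P *m v.
have -> : (map_mx Num.conj v)^T *m map_mx Num.conj P^T = (map_mx Num.conj u)^T.
  by rewrite /u map_mxM trmx_mul !map_trmx.
rewrite -/u mxE; apply: sumr_ge0 => i _.
rewrite mul_mx_diag !mxE.
have /complex_realP[x spE] := spreal 0 i.
have xev : eigenvalue Q x.
  by rewrite -(eigenvalue_map f); have := spev i; rewrite spE.
rewrite spE mulrAC mulr_ge0 ?[_^* * _]mulrC ?mul_conjC_ge0//.
by rewrite -!rmorphD -rmorphM lecR Qev.
Qed.

(** * Euclidean norm and Cauchy-Schwarz *)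

Lemma enorm_ge0 (R : realType) (n : nat) (s : 'cV[R]_n) : 0 <= enorm s.
Proof. exact: sqrtr_ge0. Qed.

Lemma sqr_enorm (R : realType) (n : nat) (s : 'cV[R]_n) :
  enorm s ^+ 2 = (s^T *m s) 0 0.
Proof.
by rewrite -enorm_sq sqr_sqrtr// sumr_ge0// => i _; exact: sqr_ge0.
Qed.

Lemma enorm_eq0 (R : realType) (n : nat) (s : 'cV[R]_n) :
  enorm s = 0 -> s = 0.
Proof.
move=> s0; apply/colP => i; have := sqr_enorm s.
rewrite s0 expr0n/= -enorm_sq => /esym/eqP.
rewrite psumr_eq0 => [/allP/(_ i (mem_index_enum i))|j _]; last exact: sqr_ge0.
by rewrite mxE sqrf_eq0 => /eqP.
Qed.

(** For [x = enorm v] and [y = enorm u] the right-hand side is 2 |u| |v| (|u| |v| - u.v), which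
    gives both Cauchy-Schwarz and its equality case. *)
Lemma sqr_enorm_comb (R : realType) (n : nat) (x y : R) (u v : 'cV[R]_n) :
  enorm (x *: u - y *: v) ^+ 2
  = x ^+ 2 * enorm u ^+ 2 - 2 * x * y * (u^T *m v) 0 0 + y ^+ 2 * enorm v ^+ 2.
Proof.
rewrite !sqr_enorm !mxE !mulr_sumr -sumrB -big_split/=.
by apply: eq_bigr => i _; rewrite !mxE; ring.
Qed.

Lemma dot_le_enorm (R : realType) (n : nat) (u v : 'cV[R]_n) :
  0 < enorm v -> (u^T *m v) 0 0 <= enorm u * enorm v.
Proof.
move=> v0; have := sqr_enorm_comb (enorm v) (enorm u) u v.
have := sqr_ge0 (enorm (enorm v *: u - enorm u *: v)).
have := enorm_ge0 u; rewrite le_eqVlt => /predU1P[/esym u0 _ _|u0 + E].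
  by rewrite u0 (enorm_eq0 u0) trmx0 mul0mx mxE mul0r.
rewrite E => H; have : 0 < 2 * (enorm u * enorm v) by rewrite !mulr_gt0.
by move=> /ler_pM2l <-; lra.
Qed.

Lemma dot_eq_enorm (R : realType) (n : nat) (u v : 'cV[R]_n) :
  (u^T *m v) 0 0 = enorm u * enorm v -> enorm v *: u = enorm u *: v.
Proof.
move=> E; apply/eqP; rewrite -subr_eq0; apply/eqP/enorm_eq0/eqP.
by rewrite -sqrf_eq0 sqr_enorm_comb E; apply/eqP; ring.
Qed.

(** * Eigenvalues between multipliers *)

Lemma eigenvalue_between (R : realType) (n : nat) (c : 'cV[R]_n)
    (Q : 'M[R]_n) (sigma : R) (p q r : 'cV[R]_n) :
  Q^T = Q -> 0 < sigma ->
  c + Q *m p + (sigma * enorm p) *: p = 0 ->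
  c + Q *m q + (sigma * enorm q) *: q = 0 ->
  c + Q *m r + (sigma * enorm r) *: r = 0 ->
  enorm p < enorm q -> enorm q < enorm r ->
  exists2 x, eigenvalue Q x & - (sigma * enorm r) < x < - (sigma * enorm p).
Proof.
move=> Qs s0 Ep Eq Er pq qr; apply: contrapT => nQ.
have q0 : 0 < enorm q by exact: le_lt_trans (enorm_ge0 p) pq.
set a := sigma * enorm p in Ep nQ; set b := sigma * enorm q in Eq.
set d := sigma * enorm r in Er nQ.
have ab : a < b by rewrite ltr_pM2l.
have bd : b < d by rewrite ltr_pM2l.
have Qev x : eigenvalue Q x -> 0 <= (x + a) * (x + d).
  move=> xQ; have [xd|dx] := lerP x (- d).
    by rewrite mulr_le0//; lra.
  have [ax|xa] := lerP (- a) x; first by rewrite mulr_ge0//; lra.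
  by case: nQ; exists x => //; apply/andP.
(* The weights sum to zero, so the terms in [Q *m c] cancel in [wE]; the remaining multiples of [c],
   from [p] and [q], cancel as well. *)
pose w := (d - b) *: p + (b - a) *: r - (d - a) *: q.
have wE : (Q + a%:M) *m (Q + d%:M) *m w = ((d - a) * (d - b) * (b - a)) *: q.
  have QE l t : c + Q *m t + l *: t = 0 -> Q *m t = - c - l *: t.
    move=> E; apply/eqP; rewrite -subr_eq0 -[X in _ == X]E; apply/eqP.
    by rewrite opprD !opprK addrA [_ + c]addrC.
  have Qp := QE _ _ Ep; have Qq := QE _ _ Eq; have Qr := QE _ _ Er.
  rewrite -mulmxA /w !mulmxDl !mul_scalar_mx !(mulmxDr, mulmxN) -!scalemxAr.
  rewrite Qp Qq Qr !(mulmxDr, mulmxN) -!scalemxAr Qp Qq Qr.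
  apply/colP => i; rewrite !mxE; ring.
have H : (d - b) * (p^T *m q) 0 0 + (b - a) * (r^T *m q) 0 0
    - (d - a) * enorm q ^+ 2 >= 0.
  have := psd_shift_mul w Qs Qev; rewrite -mulmxA wE.
  have K0 : 0 < (d - a) * (d - b) * (b - a) by rewrite !mulr_gt0//; lra.
  rewrite -scalemxAr [X in 0 <= X -> _]mxE pmulr_rge0//.
  suff -> : (w^T *m q) 0 0 = (d - b) * (p^T *m q) 0 0
    + (b - a) * (r^T *m q) 0 0 - (d - a) * enorm q ^+ 2 by [].
  rewrite sqr_enorm !mxE !mulr_sumr -big_split/= -sumrB.
  by apply: eq_bigr => i _; rewrite !mxE; ring.
have Hp := dot_le_enorm p q0; have Hr := dot_le_enorm r q0.
have p_gap : 0 <= (d - b) * (enorm p * enorm q - (p^T *m q) 0 0).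
  by rewrite mulr_ge0 ?subr_ge0// ltW.
have r_gap : 0 <= (b - a) * (enorm r * enorm q - (r^T *m q) 0 0).
  by rewrite mulr_ge0 ?subr_ge0// ltW.
(* This uses (d - b) |p| + (b - a) |r| = (d - a) |q|. By [H] the two nonnegative gaps have a
   nonpositive sum, so both vanish. *)
have gapsE : (d - b) * (enorm p * enorm q - (p^T *m q) 0 0)
    + (b - a) * (enorm r * enorm q - (r^T *m q) 0 0)
    = - ((d - b) * (p^T *m q) 0 0 + (b - a) * (r^T *m q) 0 0
         - (d - a) * enorm q ^+ 2) by rewrite /a /b /d; ring.
have Hp' : (p^T *m q) 0 0 = enorm p * enorm q.
  apply/esym/subr0_eq/(@mulfI _ (d - b)); first by rewrite gt_eqF// subr_gt0.
  by rewrite mulr0; apply/eqP; rewrite eq_le p_gap andbT; lra.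
have Hr' : (r^T *m q) 0 0 = enorm r * enorm q.
  apply/esym/subr0_eq/(@mulfI _ (b - a)); first by rewrite gt_eqF// subr_gt0.
  by rewrite mulr0; apply/eqP; rewrite eq_le r_gap andbT; lra.
have pE := dot_eq_enorm Hp'; have rE := dot_eq_enorm Hr'.
(* Eliminating [c] between the equations of [p] and [q] gives Q q = - sigma (|p| + |q|) q, and those
   of [q] and [r] give Q q = - sigma (|q| + |r|) q. The factors differ, so q = 0. *)
have : q = 0.
  have scaled x l t : enorm q *: t = x *: q -> c + Q *m t + l *: t = 0 ->
      enorm q *: c + x *: (Q *m q) + (l * x) *: q = 0.
    move=> tq E; rewrite scalemxAr -scalerA -tq -scalemxAr.
    rewrite scalerA [l * _]mulrC -scalerA.
    by rewrite -!scalerDr E scaler0.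
  have {}Ep := scaled _ _ _ pE Ep; have {}Er := scaled _ _ _ rE Er.
  apply/colP => i; rewrite [RHS]mxE.
  move: Ep Eq Er => /colP/(_ i) + /colP/(_ i) + /colP/(_ i).
  move: (Q *m q) => u; rewrite !mxE => Ep Eq Er.
  have up : u i 0 + sigma * (enorm q + enorm p) * q i 0 = 0.
    apply: (@mulfI _ (enorm q - enorm p)); first by rewrite gt_eqF// subr_gt0.
    transitivity (enorm q * (c i 0 + u i 0 + b * q i 0)
      - (enorm q * c i 0 + enorm p * u i 0 + a * enorm p * q i 0)).
      by rewrite /a /b; ring.
    by rewrite Ep Eq; ring.
  have ur : u i 0 + sigma * (enorm r + enorm q) * q i 0 = 0.
    apply: (@mulfI _ (enorm r - enorm q)); first by rewrite gt_eqF// subr_gt0.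
    transitivity ((enorm q * c i 0 + enorm r * u i 0 + d * enorm r * q i 0)
      - enorm q * (c i 0 + u i 0 + b * q i 0)).
      by rewrite /b /d; ring.
    by rewrite Er Eq; ring.
  apply: (@mulfI _ (d - a)); first by rewrite gt_eqF// subr_gt0 (lt_trans ab).
  transitivity ((u i 0 + sigma * (enorm r + enorm q) * q i 0)
    - (u i 0 + sigma * (enorm q + enorm p) * q i 0)).
    by rewrite /a /d; ring.
  by rewrite up ur subrr mulr0.
move=> qz; have := sqr_enorm q; rewrite [in RHS]qz mulmx0 mxE => /eqP.
by rewrite sqrf_eq0 gt_eqF.
Qed.

(** * Values at stationary points *)

(** Pairing each equation with the other point gives c.s = c.t, by symmetry of [Q] and equality of
    the norms. Pairing it with its own point gives m(s) = c.s / 2 - sigma |s|^3 / 6. *)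
Lemma stationary_value (R : realType) (n : nat) (c : 'cV[R]_n)
    (Q : 'M[R]_n) (sigma : R) (s t : 'cV[R]_n) :
  Q^T = Q ->
  c + Q *m s + (sigma * enorm s) *: s = 0 ->
  c + Q *m t + (sigma * enorm t) *: t = 0 ->
  enorm s = enorm t -> cubic_model c Q sigma s = cubic_model c Q sigma t.
Proof.
move=> Qs Es Et st.
have dot_c (u v : 'cV[R]_n) : c + Q *m u + (sigma * enorm u) *: u = 0 ->
    (c^T *m v) 0 0 = - (u^T *m Q *m v) 0 0 - sigma * enorm u * (u^T *m v) 0 0.
  move=> /(congr1 (fun x => (x^T *m v) 0 0)).
  rewrite trmx0 mul0mx [RHS]mxE !linearD linearZ/= !mulmxDl -scalemxAl.
  rewrite trmx_mul Qs.
  have entry (x y z : 'M[R]_1) r :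
    (x + y + r *: z) 0 0 = x 0 0 + y 0 0 + r * z 0 0 by rewrite !mxE.
  by rewrite entry; lra.
have dotC : (s^T *m t) 0 0 = (t^T *m s) 0 0.
  by rewrite -[s^T *m t]mx11_tr trmx_mul trmxK.
have QC : (s^T *m Q *m t) 0 0 = (t^T *m Q *m s) 0 0.
  by rewrite -[s^T *m Q *m t]mx11_tr !trmx_mul trmxK Qs mulmxA.
have cst : (c^T *m t) 0 0 = (c^T *m s) 0 0.
  by rewrite (dot_c _ t Es) (dot_c _ s Et) dotC QC st.
have := dot_c _ s Es; have := dot_c _ t Et.
rewrite /cubic_model -!sqr_enorm cst st; lra.
Qed.

(** * Counting by interlacing *)

Lemma card_le_interlaced (d : Order.disp_t) (T : orderType d) (A E : set T)
    (k : nat) :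
  E #= `I_k ->
  (forall x y z, A x -> A y -> A z -> (x < y)%O -> (y < z)%O ->
     exists2 e, E e & (x < e < z)%O) ->
  A #<= `I_(2 * k.+1).
Proof.
move=> Ek AE; apply: contrapT => nA.
have [B BA Bk] : exists2 B : {fset T}, [set` B] `<=` A & (2 * k.+1 < #|` B|)%N.
  have [Afin|/infinite_set_fset] := pselect (finite_set A); last exact.
  exists (fset_set A); first by rewrite fset_setK.
  have [m Am] := (finite_setP A).1 Afin.
  rewrite (card_fset_set Am) ltnNge; apply/negP => mk; apply: nA.
  by rewrite (card_le_eql Am) card_le_II.
have [x0 _] : exists x, x \in B.
  by apply/fset0Pn; rewrite -cardfs_gt0 (leq_ltn_trans _ Bk).
pose s := sort <=%O B; pose x i := nth x0 s i.
have xA i : (i < #|` B|)%N -> A (x i).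
  by move=> iB; apply: BA; rewrite /= -(mem_sort <=%O) mem_nth// size_sort.
have x_lt i j : (i < j)%N -> (j < #|` B|)%N -> (x i < x j)%O.
  move=> ij jB; have ssort : sorted <%O s by rewrite sort_lt_sorted fset_uniq.
  apply: (sorted_ltn_nth lt_trans x0 ssort); rewrite ?inE ?size_sort//.
  exact: ltn_trans ij jB.
(* The last index used is 2 k + 2, so 2 k + 3 points are needed, exactly what [Bk] provides.
   Consecutive intervals share only an endpoint, which makes the chosen [e i] distinct. *)
have e_ex (i : 'I_k.+1) : exists e, E e /\ (x (2 * i)%N < e < x (2 * i).+2%N)%O.
  have h2 : ((2 * i).+2 < #|` B|)%N.
    by apply: leq_ltn_trans Bk; have := ltn_ord i; lia.
  have h1 := ltnW h2; have h0 := ltnW h1.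
  have [e Ee xe] := AE _ _ _ (xA _ h0) (xA _ h1) (xA _ h2)
    (x_lt _ _ (ltnSn _) h1) (x_lt _ _ (ltnSn _) h2).
  by exists e.
have [e eP] := choice e_ex.
have e_lt (i j : 'I_k.+1) : (i < j)%N -> (e i < e j)%O.
  move=> ij; have jk := ltn_ord j.
  have [_ /andP[_ ei]] := eP i; have [_ /andP[ej _]] := eP j.
  apply: (lt_trans ei); apply: le_lt_trans ej.
  have [->//|ne] := eqVneq (2 * i).+2%N (2 * j)%N.
  by apply/ltW/x_lt; lia.
have e_inj : injective e.
  move=> i j eij; apply/val_inj.
  by have [/e_lt|/e_lt|] := ltngtP (val i) (val j); rewrite // eij ltxx.
suff : `I_k.+1 #<= `I_k by rewrite card_le_II ltnn.
rewrite -(card_le_eqr Ek).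
suff /injfunPex[g] : exists2 f : nat -> T, set_fun `I_k.+1 E f
  & set_inj `I_k.+1 f by exact: inj_card_le g.
exists (fun i => e (inord i)) => [i _|i j]; first by have [] := eP (inord i).
move=> /set_mem/= ik /set_mem/= jk /e_inj /(congr1 val).
by rewrite /= !inordK.
Qed.

Theorem corollary1 (R : realType) (n : nat) (c : 'cV[R]_n) (Q : 'M[R]_n)
    (sigma : R) (k : nat)
    (Qsym : Q^T = Q)
    (sigma_gt0 : 0 < sigma)
    (kE : [set a : R | eigenvalue Q a /\ a < 0] #= `I_k) :
  [set cubic_model c Q sigma s | s in [set s : 'cV[R]_n |
     stationary (cubic_model c Q sigma) s]] #<= `I_(2 * k.+1).
Proof.
(* The sign in [mult] puts multipliers on the scale of the eigenvalues, at the price of reversing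
   the order of the norms. *)
set S := [set s | _]; pose mult (s : 'cV[R]_n) : R := - (sigma * enorm s).
have S_eq s : S s -> c + Q *m s + (sigma * enorm s) *: s = 0.
  exact: (stationary_cubic_model c sigma s Qsym).1.
suff multS : mult @` S #<= `I_(2 * k.+1).
  apply: (card_le_trans _ multS).
  (* [g] reads the value off the multiplier through a chosen stationary point; the default 0 is
     never taken on the image of [mult]. *)
  pose g l := cubic_model c Q sigma (xget 0 (S `&` mult @^-1` [set l])).
  apply: card_le_trans (card_image_le g _); apply: subset_card_le.
  move=> _ [s Ss <-]; exists (mult s); first by exists s.
  have [St] := xgetPex 0 (ex_intro _ s (conj Ss erefl) :
    exists t, (S `&` mult @^-1` [set mult s]) t).
  move=> /oppr_inj/(mulfI (lt0r_neq0 sigma_gt0)) st.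
  by apply: stationary_value st; rewrite ?S_eq.
apply: (card_le_interlaced kE) => x1 x2 x3 [r /S_eq Er <-] [q /S_eq Eq <-].
move=> [p /S_eq Ep <-]; rewrite !ltrN2 !ltr_pM2l// => qr pq.
have [x xQ /andP[rx xp]] := eigenvalue_between Qsym sigma_gt0 Ep Eq Er pq qr.
exists x; last exact/andP.
(* The eigenvalue is negative because it lies below - sigma |p| <= 0. *)
split=> //; apply: lt_le_trans xp _.
by rewrite oppr_le0 mulr_ge0 ?enorm_ge0// ltW.
Qed.
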